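(* Let $m\ge1$ and $d\ge2$ be integers with $\gcd(m,d)=1$. For $v\in\mathbb{Z}_m$ let $o(v)$ be the size of the orbit $\{v,dv,d^2v,\dots\}$ of $v$ under the permutation $v\mapsto dv$ of $\mathbb{Z}_m$, and let $\mathcal V$ be a set containing exactly one element from each orbit other than $\{0\}$. Then $\Sigma(m,d)\cong\bigoplus_{v\in\mathcal V}\mathbb{Z}_{d^{o(v)}-1}$.
   Context: In $\mathbb{Q}[x]/(x^m-1)$ (exponents mod $m$) put $e_v=x^v-1$, $\epsilon_v=d\,e_v-e_{dv}$; $\mathcal Z_m$ = $\mathbb{Z}$-span of $e_1,\dots,e_{m-1}$, $\mathcal E_{m,d}$ = $\mathbb{Z}$-span of $\epsilon_1,\dots,\epsilon_{m-1}$, and $\Sigma(m,d)=\mathcal Z_m/\mathcal E_{m,d}$. *)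

(* Defs.v *)
From HB Require Import structures.
From mathcomp Require Import all_boot all_order all_algebra.

Set Implicit Arguments.
Unset Strict Implicit.
Unset Printing Implicit Defensive.

Import GRing.Theory.
Local Open Scope ring_scope.

(* The additive group Z/nZ, for every n >= 1.  The notation 'Z_n is avoided
   because 'Z_1 is Z/2Z. *)
Notation Zmod n := 'I_n.-1.+1.

Section IntSpan.
Variable vT : vectType rat.
Implicit Types (s : seq vT) (v : vT).

(* inIntSpan as a boolean predicate, through its decision procedure on
   Q-vector spaces. *)
Definition zspan s : {pred vT} := fun v => dec_Qint_span (in_tuple s) v.

Lemma zspanP s v : reflect (inIntSpan (in_tuple s) v) (v \in zspan s).
Proof. exact: sumboolP. Qed.

Lemma zspan_zmod_closed s : zmod_closed (zspan s).
Proof.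
split=> [|u v /zspanP[a ->] /zspanP[b ->]]; apply/zspanP.
  by exists 0; rewrite big1 // => i _; rewrite ffunE mulr0z.
exists (a - b); rewrite -sumrB; apply: eq_bigr => i _.
by rewrite !ffunE mulrzBr.
Qed.

HB.instance Definition _ s :=
  GRing.isZmodClosed.Build vT (zspan s) (zspan_zmod_closed s).

Lemma mem_zspan s : {subset s <= zspan s}.
Proof.
move=> v s_v; apply/zspanP; have lt_v : (index v s < size s)%N by rewrite index_mem.
exists [ffun i => (i == Ordinal lt_v)%:R].
rewrite (bigD1 (Ordinal lt_v)) //= ffunE eqxx mulr1z nth_index //.
by rewrite big1 ?addr0 // => i /negPf i'v; rewrite ffunE i'v mulr0z.
Qed.

Lemma zspan_sub s (S : zmodClosed vT) : {subset s <= S} -> {subset zspan s <= S}.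
Proof.
move=> sS _ /zspanP[a ->]; apply: rpred_sum => i _; apply: rpredMz.
by apply: sS; rewrite mem_nth.
Qed.

End IntSpan.

Section Lattices.
Variable m : nat.

(* Q[x]/(x^m - 1).  For m = 0 the modulus is not an admissible one and the
   type {poly %/ _} falls back to the modulus 'X. *)
Definition cycalg := {poly %/ ('X^m - 1 : {poly rat})}.
HB.instance Definition _ := GRing.ComUnitAlgebra.on cycalg.
HB.instance Definition _ := Vector.on cycalg.

Definition cyc_e (v : nat) : cycalg := 'qX ^+ v - 1.

Definition cyc_eps (d v : nat) : cycalg := cyc_e v *+ d - cyc_e (d * v).

Definition Zlat_pred : {pred cycalg} := zspan [seq cyc_e v | v <- iota 1 m.-1].
HB.instance Definition _ := GRing.ZmodClosed.on Zlat_pred.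

Record Zlat := MkZlat { Zlat_val :> cycalg; _ : Zlat_val \in Zlat_pred }.
HB.instance Definition _ := [isSub for Zlat_val].
HB.instance Definition _ := [Choice of Zlat by <:].
HB.instance Definition _ := [SubChoice_isSubZmodule of Zlat by <:].

Definition Elat_pred (d : nat) : {pred cycalg} :=
  zspan [seq cyc_eps d v | v <- iota 1 m.-1].
HB.instance Definition _ d := GRing.ZmodClosed.on (Elat_pred d).

(* The span of the cyc_eps d v, as a subgroup of Zlat; that it lies inside Zlat
   is Elat_sub_Zlat below. *)
Definition Elat (d : nat) : {pred Zlat} := fun z => Zlat_val z \in Elat_pred d.

Lemma Elat_zmod_closed d : zmod_closed (Elat d).
Proof.
split=> [|x y Ex Ey]; first by rewrite unfold_in rpred0.
by rewrite unfold_in; apply: rpredB.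
Qed.
HB.instance Definition _ d :=
  GRing.isZmodClosed.Build Zlat (Elat d) (Elat_zmod_closed d).

Definition Sigma (d : nat) := Quotient.quot (Elat d).
HB.instance Definition _ d := GRing.Zmodule.on (Sigma d).

Hypothesis m_gt0 : (0 < m)%N.

Lemma cycX_m : 'qX ^+ m = 1 :> cycalg.
Proof.
pose h : {poly rat} := 'X^m - 1.
have szh : (1 < size h)%N by rewrite size_XnsubC.
have mo_h : h \is monic by rewrite monicXnsubC.
rewrite -[LHS]/(in_qpoly h 'X ^+ m) -rmorphXn -[RHS](in_qpoly1 h) /=.
apply/eqP; rewrite -subr_eq0 -raddfB /=; apply/eqP/val_inj => /=.
by rewrite /mk_monic szh mo_h Pdiv.RingMonic.rmodpp.
Qed.

Lemma cyc_e_mod v : cyc_e (v %% m) = cyc_e v.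
Proof.
by rewrite /cyc_e [in RHS](divn_eq v m) exprD mulnC exprM cycX_m expr1n mul1r.
Qed.

Lemma cyc_e_Zlat v : cyc_e v \in Zlat_pred.
Proof.
rewrite -cyc_e_mod; case: (posnP (v %% m)%N) => [->|v_gt0].
  by rewrite /cyc_e expr0 subrr rpred0.
apply: mem_zspan; apply/mapP; exists (v %% m)%N => //.
by rewrite mem_iota v_gt0 add1n prednK // ltn_mod.
Qed.

Lemma Elat_sub_Zlat d : {subset Elat_pred d <= Zlat_pred}.
Proof.
apply: zspan_sub => _ /mapP[v _ ->].
by rewrite /cyc_eps rpredB ?rpredMn ?cyc_e_Zlat.
Qed.

End Lattices.

Section DirectSum.
Variables (I : finType) (T : I -> zmodType).

(* Over a finite index set the direct sum is the direct product. *)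
Definition dirsum := {dffun forall i, T i}.
HB.instance Definition _ := Choice.on dirsum.

Definition dirsum_add (f g : dirsum) : dirsum := [ffun i => f i + g i].
Definition dirsum_opp (f : dirsum) : dirsum := [ffun i => - f i].
Definition dirsum_zero : dirsum := [ffun i => 0].

Lemma dirsum_addA : associative dirsum_add.
Proof. by move=> f g h; apply/ffunP => i; rewrite !ffunE addrA. Qed.
Lemma dirsum_addC : commutative dirsum_add.
Proof. by move=> f g; apply/ffunP => i; rewrite !ffunE addrC. Qed.
Lemma dirsum_add0 : left_id dirsum_zero dirsum_add.
Proof. by move=> f; apply/ffunP => i; rewrite !ffunE add0r. Qed.
Lemma dirsum_addN : left_inverse dirsum_zero dirsum_opp dirsum_add.
Proof. by move=> f; apply/ffunP => i; rewrite !ffunE addNr. Qed.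

HB.instance Definition _ := GRing.isZmodule.Build dirsum
  dirsum_addA dirsum_addC dirsum_add0 dirsum_addN.

End DirectSum.

Section Orbits.
Variables m d : nat.
Implicit Type v : Zmod m.

Definition mulmap v : Zmod m := v *+ d.

Definition dorbit v : {set Zmod m} := [set w in orbit mulmap v].

Definition orbit_size v : nat := #|dorbit v|.

Definition orbit_reps (V : {set Zmod m}) : Prop :=
  0 \notin V /\ forall v, dorbit v != [set 0] -> #|V :&: dorbit v| = 1%N.

End Orbits.

Definition zmod_isog (A B : zmodType) : Prop :=
  exists f : {additive A -> B}, bijective f.

(* Main.v *)
(* In Sigma(m, d) the relation e_{dw} = d e_w makes the class of e_w equal to
   d^j e_v when w = d^j v, so Sigma is generated by the classes of the e_v for
   v in V, and going once around the orbit gives (d^{o(v)} - 1) e_v = 0.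
   Conversely, as the e_w with w <> 0 form a basis of the lattice, sending
   sum_w c_w e_w to the family of sum_{j < o(v)} c_{d^j v} d^j mod d^{o(v)} - 1
   is well defined, kills every epsilon_w, and inverts x |-> sum_v x_v e_v. *)
Require Import Defs.
From HB Require Import structures.
From mathcomp Require Import all_boot all_order all_algebra.

Set Implicit Arguments.
Unset Strict Implicit.
Unset Printing Implicit Defensive.

Import GRing.Theory.

(** * The cyclic group of order $n$ and its generator *)

Section ZmodGenerator.
Local Open Scope ring_scope.
Variable n : nat.
Hypothesis n_gt0 : (0 < n)%N.

(** The class of 1; for $n=1$ the group is trivial and this class is 0. *)
Definition Zmod_gen : Zmod n := inZp 1.

Lemma val_Zmod_genMn k : Zmod_gen *+ k = (k %% n)%N :> nat.
Proof. by rewrite Zp_mulrn /= prednK // modnMml mul1n. Qed.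

Lemma Zmod_genMn_order : Zmod_gen *+ n = 0.
Proof. by apply: val_inj; rewrite /= val_Zmod_genMn modnn. Qed.

Lemma Zmod_genMn_val (x : Zmod n) : Zmod_gen *+ x = x.
Proof.
by apply: val_inj; rewrite /= val_Zmod_genMn modn_small // -[ltnRHS]prednK.
Qed.

Lemma mulrn_modn (A : zmodType) (y : A) k : y *+ n = 0 -> y *+ (k %% n) = y *+ k.
Proof.
by move=> yn0; rewrite [in RHS](divn_eq k n) mulrnDr mulnC mulrnA yn0 mul0rn add0r.
Qed.

(** The exponent on the left is the representative of $a$ in $[0,n)$; it differs from $a$ by a
    multiple of $n$, which kills $y$. *)
Lemma mulrn_Zmod_genMz (A : zmodType) (y : A) (a : int) :
  y *+ n = 0 -> y *+ (Zmod_gen *~ a) = y *~ a.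
Proof.
move=> yn0; case: a => k; first by rewrite -pmulrn val_Zmod_genMn mulrn_modn.
rewrite NegzE !mulrNz -!pmulrn /= val_Zmod_genMn prednK // mulrn_modn //.
by rewrite mulrnBr ?yn0 ?sub0r ?mulrn_modn // ltnW ?ltn_mod.
Qed.

End ZmodGenerator.

(** * Orbits of multiplication by $d$ on residues modulo $m+1$ *)

Section Orbits.
Local Open Scope ring_scope.
Variables m d : nat.
Hypothesis co_md : coprime m.+1 d.

Local Notation f := (@mulmap m.+1 d).
Local Notation orb := (@dorbit m.+1 d).

(** By Gauss's lemma, $m+1$ divides $z$ as soon as it divides $dz$. Injectivity on a finite set
    makes [mulmap] a permutation, so lying in the same orbit is symmetric. *)
Lemma mulmap_inj : injective f.
Proof.
move=> x y /eqP; rewrite -subr_eq0 /mulmap -mulrnBl => /eqP.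
move: (x - y) (subr0_eq (x := x) (y := y)) => z xyz; rewrite Zp_mulrn.
move=> /(congr1 val) /= /eqP; rewrite -/(dvdn _ _) Gauss_dvdl // => /eqP.
by rewrite modn_small ?ltn_ord // => z0; apply: xyz; apply: val_inj.
Qed.

Lemma mem_dorbit v w : (w \in orb v) = fconnect f v w.
Proof. by rewrite inE fconnect_orbit. Qed.

Lemma dorbit_sym v w : (w \in orb v) = (v \in orb w).
Proof. by rewrite !mem_dorbit fconnect_sym //; exact: mulmap_inj. Qed.

Lemma orbit_sizeE v : @orbit_size m.+1 d v = order f v.
Proof. by rewrite /orbit_size cardsE (card_uniqP (orbit_uniq _ _)) size_orbit. Qed.

Lemma mulmap_dorbit v w : (f w \in orb v) = (w \in orb v).
Proof.
by rewrite !(dorbit_sym v) !mem_dorbit -same_fconnect1 //; exact: mulmap_inj.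
Qed.

Lemma dorbit_neq0 (v : 'I_m.+1) w : v != 0 -> w \in orb v -> w != 0.
Proof.
move=> v0; apply: contraTneq => ->; rewrite dorbit_sym mem_dorbit.
apply: contra v0 => /iter_findex <-.
by elim: (findex _ _ _) => //= k /eqP ->; rewrite /mulmap mul0rn.
Qed.

Lemma dorbit_neq_set0 (v : 'I_m.+1) : v != 0 -> orb v != [set 0].
Proof.
by apply: contraNneq => E; rewrite -in_set1 -E mem_dorbit connect0.
Qed.

(** The exponent [findex f v u] grows by one under [f], except at the last point of the orbit, where
    it drops back to 0; there $d^{o(v)}y=y$ makes up for the drop. *)
Lemma mulrn_expn_findex (A : zmodType) (y : A) v u :
    (0 < d)%N -> y *+ (d ^ @orbit_size m.+1 d v - 1) = 0 -> u \in orb v ->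
  y *+ d ^ findex f v (f u) = y *+ d ^ findex f v u *+ d.
Proof.
rewrite orbit_sizeE mem_dorbit -mulrnA -expnSr => d_gt0 yn0 vu.
rewrite -{1}(iter_findex vu) -iterS.
move: (findex_max vu); rewrite leq_eqVlt => /orP[/eqP ->|lt_j].
  rewrite iter_order; last exact: mulmap_inj.
  rewrite findex0 expn0 mulr1n -(subnK (n := d ^ order f v) (m := 1)) ?expn_gt0 ?d_gt0 //.
  by rewrite mulrnDr yn0 add0r.
by rewrite findex_iter.
Qed.

End Orbits.

(** * Coordinates in the lattice spanned by the $e_w$ *)

Section Coefficients.
Local Open Scope ring_scope.
Variable m : nat.
Local Notation Z := (Zlat m.+1).
Implicit Types (u w : 'I_m.+1) (z : Z).

Definition cyc_coef (k : nat) (x : cycalg m.+1) : rat := (val x : {poly rat})`_k.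

Lemma cyc_coefB k : zmod_morphism (cyc_coef k).
Proof. by move=> x y; rewrite /cyc_coef raddfB coefB. Qed.

HB.instance Definition _ k :=
  GRing.isZmodMorphism.Build (cycalg m.+1) rat (cyc_coef k) (cyc_coefB k).

(** As $u\le m$, the monomial $x^u$ is its own remainder modulo $x^{m+1}-1$. *)
Lemma cyc_coefXn (u : 'I_m.+1) k : cyc_coef k ('qX ^+ u) = (k == u)%:R.
Proof.
pose h : {poly rat} := 'X^(m.+1) - 1.
have mo_h : h \is monic by rewrite monicXnsubC.
have sz : size h = m.+2 by rewrite size_XnsubC.
have -> : 'qX ^+ u = in_qpoly h 'X^u :> cycalg m.+1 by rewrite rmorphXn.
have inX : in_qpoly h 'X^u = 'X^u :> {poly rat}.
  by apply: in_qpoly_small; rewrite /mk_monic sz mo_h sz size_polyXn ltnS.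
transitivity (('X^u : {poly rat})`_k); last by rewrite coefXn.
exact: (congr1 (fun p : {poly rat} => p`_k) inX).
Qed.

(** The $-1$ in $e_u$ touches only the constant term, so away from it the coefficient of $x^w$ reads
    off that of $e_w$. *)
Lemma cyc_coef_e (u w : 'I_m.+1) : w != 0 -> cyc_coef w (cyc_e m.+1 u) = (u == w)%:R.
Proof.
move=> w0; rewrite /cyc_e raddfB /= cyc_coefXn -(expr0 'qX).
by rewrite (cyc_coefXn ord0) (negPf (w0 : val w != 0%N)) subr0 eq_sym.
Qed.

Definition lat_e (w : 'I_m.+1) : Z := MkZlat (cyc_e_Zlat (ltn0Sn m) w).

(** For $w\ne0$, the coordinate along $e_w$; [numq] recovers the integer from a coefficient that is
    rational by type. *)
Definition lat_coef (w : 'I_m.+1) (z : Z) : int := numq (cyc_coef w (val z)).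

Lemma lat_decomp (z : Z) :
  exists b : 'I_m.+1 -> int, val z = \sum_(w < m.+1) cyc_e m.+1 w *~ b w.
Proof.
case: z => z /= /zspanP [a ->].
(* Position $k$ of the list holds $e_{k+1}$, hence the shift [w.-1] below; [A] extends [a] by 0. The
   value taken at $w=0$ is harmless because $e_0=0$. *)
pose A k := if insub k is Some i then a i else 0.
exists (fun w : 'I_m.+1 => A w.-1).
rewrite big_ord_recl /= /cyc_e expr0 subrr mul0rz add0r.
set s := map _ _.
transitivity (\sum_(i < size s) s`_i *~ A i).
  by apply: eq_bigr => i _; rewrite /A valK.
rewrite -(big_mkord xpredT (fun i => s`_i *~ A i)) size_map size_iota big_mkord.
by apply: eq_bigr => i _; rewrite (nth_map 0%N) ?size_iota // nth_iota.
Qed.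

Lemma lat_coefE (w : 'I_m.+1) (z : Z) (b : 'I_m.+1 -> int) :
  w != 0 -> val z = \sum_(u < m.+1) cyc_e m.+1 u *~ b u ->
  cyc_coef w (val z) = (b w)%:~R.
Proof.
move=> w0 ->; rewrite raddf_sum (bigD1 w) //= big1 => [|u /negPf uw].
  by rewrite raddfMz /= cyc_coef_e // eqxx addr0.
by rewrite raddfMz /= cyc_coef_e // uw mul0rz.
Qed.

Lemma lat_coefP w z : w != 0 -> cyc_coef w (val z) = (lat_coef w z)%:~R.
Proof.
move=> w0; have [b zE] := lat_decomp z.
by rewrite /lat_coef (lat_coefE w0 zE) numq_int.
Qed.

Lemma lat_coefB w : w != 0 -> {morph lat_coef w : x y / x - y}.
Proof.
move=> w0 x y; apply: (@intr_inj rat); rewrite -lat_coefP //.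
by rewrite rmorphB /= -!lat_coefP // raddfB.
Qed.

Lemma lat_coef_e w u : w != 0 -> lat_coef w (lat_e u) = (u == w)%:R.
Proof.
by move=> w0; apply: (@intr_inj rat); rewrite -lat_coefP // cyc_coef_e // rmorph_nat.
Qed.

Lemma lat_e0 : lat_e 0 = 0.
Proof. by apply: val_inj; rewrite /= /cyc_e expr0 subrr. Qed.

Lemma lat_sum z : z = \sum_(w | w != 0) lat_e w *~ lat_coef w z.
Proof.
have [b zE] := lat_decomp z; apply: val_inj.
have e0 : cyc_e m.+1 (ord0 : 'I_m.+1) = 0 by rewrite /cyc_e expr0 subrr.
transitivity (\sum_(w < m.+1 | w != 0) cyc_e m.+1 w *~ b w).
  by rewrite zE (bigD1 0) //= e0 mul0rz add0r.
rewrite raddf_sum; apply: eq_bigr => w w0; rewrite raddfMz; congr (_ *~ _).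
by rewrite /lat_coef (lat_coefE w0 zE) numq_int.
Qed.

End Coefficients.

(** * Coordinate projections of a direct sum *)

Section DirsumProjection.
Local Open Scope ring_scope.
Variables (I : finType) (T : I -> zmodType).

(** A named function can carry an additive structure, so that sums and multiples are computed
    coordinatewise. *)
Definition dirsum_proj (i : I) (x : dirsum T) : T i := x i.

Lemma dirsum_projB i : zmod_morphism (dirsum_proj i).
Proof. by move=> x y; rewrite /dirsum_proj !ffunE. Qed.

HB.instance Definition _ i :=
  GRing.isZmodMorphism.Build (dirsum T) (T i) (dirsum_proj i) (dirsum_projB i).

End DirsumProjection.

(** * Relations in the quotient and the map from the lattice to the direct sum *)

Section Isomorphism.
Local Open Scope ring_scope.
Local Open Scope quotient_scope.
Variables m d : nat.
Hypothesis d_gt1 : (1 < d)%N.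
Hypothesis co_md : coprime m.+1 d.
Variable V : {set 'I_m.+1}.
Hypothesis V_reps : @orbit_reps m.+1 d V.

Local Notation f := (@mulmap m.+1 d).
Local Notation orb := (@dorbit m.+1 d).
Local Notation Z := (Zlat m.+1).
Local Notation S := (Sigma m.+1 d).
Local Notation I := {v : 'I_m.+1 | v \in V}.
Local Notation ord_ v := (d ^ @orbit_size m.+1 d v - 1)%N.
Local Notation D := (dirsum (fun v : I => Zmod (ord_ (val v)))).

Implicit Types (u v w : 'I_m.+1) (z : Z).

Let pi (z : Z) : S := \pi_S z.

Lemma ord_gt0 v : (0 < ord_ v)%N.
Proof.
rewrite subn_gt0 -[ltnLHS](expn0 d) ltn_exp2l // orbit_sizeE; exact: order_gt0.
Qed.

Lemma reps_neq0 v : v \in V -> v != 0.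
Proof. by case: V_reps => V0 _ Vv; apply: contraNneq V0 => <-. Qed.

Lemma val_lat_eps w : val (lat_e w *+ d - lat_e (f w)) = cyc_eps m.+1 d w.
Proof.
rewrite raddfB raddfMn /= /cyc_eps /mulmap Zp_mulrn /=.
by rewrite cyc_e_mod // mulnC.
Qed.

Lemma pi_lat_e_mul w : pi (lat_e (f w)) = pi (lat_e w) *+ d.
Proof.
rewrite /pi -raddfMn; apply/eqP; rewrite eq_sym -Quotient.idealrBE.
(* The generators $\epsilon_w$ are indexed by $1\le w\le m$, so $w=0$ is treated apart; there
   $e_0=0$. *)
case: (eqVneq w 0) => [->|w0].
  by rewrite /mulmap mul0rn lat_e0 mul0rn subrr rpred0.
apply: mem_zspan; apply/mapP; exists (val w); last exact: val_lat_eps.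
by rewrite mem_iota lt0n w0 add1n ltn_ord.
Qed.

Lemma pi_lat_e_findex v w : w \in orb v ->
  pi (lat_e w) = pi (lat_e v) *+ d ^ findex f v w.
Proof.
rewrite mem_dorbit => vw; rewrite -{1}(iter_findex vw).
elim: (findex f v w) => [|k IH]; first by rewrite expn0.
by rewrite iterS pi_lat_e_mul IH expnSr mulrnA.
Qed.

Lemma pi_lat_e_ord v : pi (lat_e v) *+ ord_ v = 0.
Proof.
rewrite mulrnBr ?expn_gt0 ?(ltnW d_gt1) // mulr1n orbit_sizeE; apply/eqP.
(* With $v$ on the right replaced by $f^{o(v)}(v)$, the claim is the case $k=o(v)$ of $d^k
   e_v=e_{f^k(v)}$, proved by induction on $k$. *)
rewrite subr_eq0; apply/eqP; rewrite -[in RHS](iter_order (mulmap_inj co_md) v).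
elim: (order f v) => [|k IH]; first by rewrite expn0.
by rewrite iterS pi_lat_e_mul -IH expnSr mulrnA.
Qed.

(* [findex f v w] is the j < o(v) with w = d^j v. *)
Definition orbit_coef (v : 'I_m.+1) (z : Z) : int :=
  \sum_(w in orb v) lat_coef w z *+ d ^ findex f v w.

Definition to_dirsum (z : Z) : D :=
  [ffun v : I => Zmod_gen (ord_ (val v)) *~ orbit_coef (val v) z].

Lemma orbit_coefB v : v != 0 -> zmod_morphism (orbit_coef v).
Proof.
move=> v0 x y; rewrite /orbit_coef -sumrB; apply: eq_bigr => w vw.
by rewrite lat_coefB ?mulrnBl //; apply: dorbit_neq0 vw.
Qed.

Lemma to_dirsumB : zmod_morphism to_dirsum.
Proof.
move=> x y; apply/ffunP => v; rewrite !ffunE orbit_coefB ?mulrzBr //.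
by apply: reps_neq0; exact: valP.
Qed.

HB.instance Definition _ :=
  GRing.isZmodMorphism.Build Z D to_dirsum to_dirsumB.

Lemma orbit_coef_e v u : v != 0 ->
  orbit_coef v (lat_e u) = if u \in orb v then (d ^ findex f v u)%:R else 0.
Proof.
move=> v0; rewrite /orbit_coef big_mkcond (bigD1 u) //= big1 ?addr0 => [|w wu].
  by case: ifP => // vu; rewrite lat_coef_e ?eqxx //; apply: dorbit_neq0 vu.
case: ifP => // vw; rewrite lat_coef_e ?(dorbit_neq0 co_md v0 vw) //.
by rewrite eq_sym (negPf wu) mul0rn.
Qed.

(** [f u] lies in the orbit of [v] exactly when [u] does. If so, the wrap-around of the exponent is
    absorbed because $d^{o(v)}-1$ kills the generator; if not, both coordinates are 0. *)
Lemma to_dirsum_e_mul u : to_dirsum (lat_e (f u)) = to_dirsum (lat_e u) *+ d.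
Proof.
apply/ffunP => v; rewrite -[RHS]/(dirsum_proj v _) raddfMn /= /dirsum_proj !ffunE.
have v0 := reps_neq0 (valP v).
rewrite !orbit_coef_e // mulmap_dorbit //; case: ifP => [vu|_]; last first.
  by rewrite !mulr0z mul0rn.
rewrite !natz -!pmulrn mulrn_expn_findex ?(ltnW d_gt1) //.
exact/Zmod_genMn_order/ord_gt0.
Qed.

Lemma to_dirsum_Elat z : z \in Elat d -> to_dirsum z = 0.
Proof.
move=> /zspanP [a]; set s := map _ _ => zE.
(* [L k] lifts $\epsilon_{k+1}$, the entry at position $k$, from the ambient algebra to the lattice,
   where [to_dirsum] is defined; $k<m$ keeps [inord] from its default value. *)
pose L k : Z := lat_e (inord k.+1) *+ d - lat_e (f (inord k.+1)).
have -> : z = \sum_(i < size s) L i *~ a i.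
  apply: val_inj; rewrite raddf_sum [LHS]zE; apply: eq_bigr => i _.
  have lt_im : (i < m)%N by rewrite -[ltnRHS](size_iota 1) -(size_map (cyc_eps m.+1 d)).
  rewrite raddfMz [X in _ = X *~ _]val_lat_eps inordK ?ltnS // (nth_map 0%N) ?size_iota //.
  by rewrite nth_iota.
rewrite raddf_sum big1 // => i _.
by rewrite raddfMz raddfB raddfMn /= to_dirsum_e_mul subrr mul0rz.
Qed.

Lemma to_dirsum_pi x y : pi x = pi y -> to_dirsum x = to_dirsum y.
Proof.
move=> /eqP; rewrite -Quotient.idealrBE => /to_dirsum_Elat/eqP.
by rewrite raddfB subr_eq0 => /eqP.
Qed.

(** * The induced map on the quotient and its inverse *)

Definition Sigma_to_dirsum (x : S) : D := to_dirsum (repr x).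

Lemma Sigma_to_dirsum_pi z : Sigma_to_dirsum (pi z) = to_dirsum z.
Proof. by apply: to_dirsum_pi; rewrite /pi reprK. Qed.

Lemma Sigma_to_dirsumB : zmod_morphism Sigma_to_dirsum.
Proof.
move=> x y; rewrite -[x](reprK (qT := S)) -[y](reprK (qT := S)).
by rewrite -raddfB !Sigma_to_dirsum_pi raddfB.
Qed.

HB.instance Definition _ :=
  GRing.isZmodMorphism.Build S D Sigma_to_dirsum Sigma_to_dirsumB.

(** The boolean equation lets [big_pred1] collapse a sum over the representatives whose orbit
    contains [w]. *)
Lemma rep_unique w : w != 0 ->
  exists v : I, forall v' : I, (w \in orb (val v')) = (v' == v).
Proof.
move=> w0; case: V_reps => _ /(_ w (dorbit_neq_set0 d w0))/eqP/cards1P[v Vw].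
have : v \in V :&: orb w by rewrite Vw set11.
rewrite inE => /andP[Vv _]; exists (Sub v Vv) => v'.
by rewrite -val_eqE /= -in_set1 -Vw in_setI [X in X && _](valP v') dorbit_sym.
Qed.

Definition dirsum_to_Sigma (x : D) : S := \sum_(v : I) pi (lat_e (val v)) *+ x v.

Lemma to_dirsumK z : dirsum_to_Sigma (to_dirsum z) = pi z.
Proof.
rewrite {2}(lat_sum z) /pi raddf_sum /=.
transitivity (\sum_(v : I) \sum_(w in orb (val v)) pi (lat_e w) *~ lat_coef w z).
  apply: eq_bigr => v _; rewrite ffunE mulrn_Zmod_genMz ?ord_gt0 ?pi_lat_e_ord //.
  rewrite /orbit_coef mulrz_sumr; apply: eq_bigr => w vw.
  by rewrite (pi_lat_e_findex vw) -mulr_natl natz mulrzA -pmulrn.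
(* The orbits of the representatives partition the nonzero residues, so after the exchange each [w]
   contributes one term. *)
rewrite (exchange_big_dep (fun w => w != 0)) /= => [|v w _]; last first.
  exact/(dorbit_neq0 co_md)/reps_neq0/valP.
apply: eq_bigr => w /rep_unique[v wv].
by rewrite (big_pred1 v) ?raddfMz.
Qed.

Lemma Sigma_to_dirsumK : cancel Sigma_to_dirsum dirsum_to_Sigma.
Proof. by move=> x; rewrite to_dirsumK /pi reprK. Qed.

Lemma dirsum_to_SigmaK : cancel dirsum_to_Sigma Sigma_to_dirsum.
Proof.
move=> x; apply/ffunP => v; rewrite -[LHS]/(dirsum_proj v _) !raddf_sum.
(* Only the summand at [v] survives: there the exponent is 0, leaving [x v] times the generator,
   while every other representative lies outside the orbit of [v]. *)
rewrite (bigD1 v) //= big1 ?addr0 => [|u uv].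
  rewrite !raddfMn /= Sigma_to_dirsum_pi /dirsum_proj ffunE.
  rewrite orbit_coef_e ?(reps_neq0 (valP v)) // mem_dorbit connect0 findex0.
  by rewrite expn0 mulr1z Zmod_genMn_val ?ord_gt0.
rewrite !raddfMn /= Sigma_to_dirsum_pi /dirsum_proj ffunE.
rewrite orbit_coef_e ?(reps_neq0 (valP v)) //.
have [u0 uE] := rep_unique (reps_neq0 (valP u)).
have : u == u0 by rewrite -uE mem_dorbit connect0.
by move=> /eqP eu; rewrite uE -eu eq_sym (negPf uv) mulr0z mul0rn.
Qed.

Lemma Sigma_dirsum_isog : zmod_isog S D.
Proof.
exists Sigma_to_dirsum; exists dirsum_to_Sigma.
  exact: Sigma_to_dirsumK.
exact: dirsum_to_SigmaK.
Qed.

End Isomorphism.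

Theorem theorem5p1 (m d : nat) (m_gt0 : 0 < m) (d_gt1 : 1 < d)
  (co_md : coprime m d) (V : {set Zmod m}) (V_reps : orbit_reps d V) :
  zmod_isog (Sigma m d)
    (dirsum (fun v : {v : Zmod m | v \in V} =>
       Zmod (d ^ orbit_size d (val v) - 1))).
Proof.
(* The positive modulus is written as a successor, the form used throughout. *)
case: m m_gt0 co_md V V_reps => // m _ co_md V V_reps.
exact: Sigma_dirsum_isog.
Qed.
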